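(* Let $n\ge 1$ and let $X$ be a locally $n$-connected metric space. Then for any $x\in X$, $\pi_n^{top}(X,x)$ is discrete.
   Context: For a pointed space $(X,x)$ and $n\ge 1$, let $I=[0,1]$, let $\dot{I}^n$ be the boundary of $I^n$, and let $\mathrm{Hom}((I^n,\dot{I}^n),(X,x))$ be the set of continuous maps $f:I^n\to X$ with $f(\dot{I}^n)\subseteq\{x\}$, equipped with the compact-open topology, i.e. the topology with subbase the sets $\langle K,U\rangle=\{f : f(K)\subseteq U\}$, $K\subseteq I^n$ compact, $U\subseteq X$ open. Let $p_n:\mathrm{Hom}((I^n,\dot{I}^n),(X,x))\to\pi_n(X,x)$ be the surjection sending a map to its homotopy class relative to $\dot{I}^n$. $\pi_n^{top}(X,x)$ denotes the homotopy group $\pi_n(X,x)$ equipped with the quotient topology induced by $p_n$. A space $X$ is called locally $n$-connected if for each $x\in X$ and each neighborhood $U$ of $x$ there is a neighborhood $V\subseteq U$ of $x$ such that the map $\pi_k(V)\to\pi_k(U)$ induced by inclusion is the zero (trivial) map for all $0\le k\le n$ and for all base points in $V$ (for $k=0$: any two points of $V$ lie in the same path component of $U$). *)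

(* Defs.v *)
From HB Require Import structures.
From mathcomp Require Import all_boot all_order all_algebra generic_quotient.
From mathcomp Require Import lra.
From mathcomp Require Import all_classical all_reals all_analysis.
From mathcomp Require Import homotopy.

Set Implicit Arguments.
Unset Strict Implicit.
Unset Printing Implicit Defensive.

Import Order.TTheory GRing.Theory Num.Theory.
Import numFieldNormedType.Exports.

Local Open Scope classical_set_scope.
Local Open Scope ring_scope.
Local Open Scope quotient_scope.

Definition unit_interval (R : realType) : Type :=
  set_type (`[0, 1]%classic : set R).

HB.instance Definition _ (R : realType) :=
  Topological.copy (unit_interval R) (set_type (`[0, 1]%classic : set R)).

Section unit_interval_ends.
Context (R : realType).

Lemma mem_unit_interval (s : R) : 0 <= s <= 1 -> s \in `[0, 1]%classic.
Proof. by move=> s01; apply/mem_set; rewrite /= in_itv. Qed.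

Let I0 : (0 : R) \in `[0, 1]%classic.
Proof. by apply: mem_unit_interval; rewrite lexx ler01. Qed.

Let I1 : (1 : R) \in `[0, 1]%classic.
Proof. by apply: mem_unit_interval; rewrite lexx ler01. Qed.

Let I0_neq_I1 : (exist _ 0 I0 : unit_interval R) != exist _ 1 I1.
Proof. by rewrite -val_eqE /= eq_sym oner_eq0. Qed.

HB.instance Definition _ := isBiPointed.Build (unit_interval R) I0_neq_I1.

End unit_interval_ends.

Definition unit_cube (R : realType) (n : nat) : set 'rV[R]_n :=
  [set t | forall i, 0 <= t ord0 i <= 1].

Arguments unit_cube : clear implicits.

Definition cube_boundary (R : realType) (n : nat) : set (unit_cube R n) :=
  [set t : unit_cube R n | exists i, sval t ord0 i = 0 \/ sval t ord0 i = 1].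

Arguments cube_boundary : clear implicits.

(* [set_type] inherits the subspace topology from the compact-open topology. *)
Definition hom_set (R : realType) (n : nat) (X : topologicalType) (x : X) :
    set {compact-open, unit_cube R n -> X} :=
  [set f | continuous (f : unit_cube R n -> X) /\
           f @` cube_boundary R n `<=` [set x]].

Arguments hom_set R n {X} x.

Definition hom_space (R : realType) (n : nat) (X : topologicalType) (x : X) :
  topologicalType := set_type (hom_set R n x).

Arguments hom_space R n {X} x.

Section hom_space_theory.
Context (R : realType) (n : nat) (X : topologicalType) (x : X).

Definition hom_fun (f : hom_space R n x) : unit_cube R n -> X := sval f.

Lemma hom_fun_continuous f : continuous (hom_fun f).
Proof. by case: f => f fP; case: (set_mem fP). Qed.

Lemma hom_fun_boundary f t : cube_boundary R n t -> hom_fun f t = x.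
Proof. by case: f => f fP bt; case: (set_mem fP) => _; apply; exists t. Qed.

Lemma mk_hom_subproof (f : unit_cube R n -> X) (cf : continuous f)
  (fb : forall t, cube_boundary R n t -> f t = x) : f \in hom_set R n x.
Proof. by apply/mem_set; split=> // _ [t bt <-]; exact: fb. Qed.

Definition mk_hom (f : unit_cube R n -> X) (cf : continuous f)
    (fb : forall t, cube_boundary R n t -> f t = x) : hom_space R n x :=
  exist _ f (mk_hom_subproof cf fb).

Definition cst_hom : hom_space R n x :=
  @mk_hom (cst x) (@cst_continuous _ _ x) (fun _ _ => erefl).

Definition homotopic (f g : hom_space R n x) : Prop :=
  exists H : unit_cube R n * unit_interval R -> X,
    [/\ continuous H,
        forall t, H (t, zero) = hom_fun f t,
        forall t, H (t, one) = hom_fun g t &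
        forall t s, cube_boundary R n t -> H (t, s) = hom_fun f t].

End hom_space_theory.

Section homotopic_equivalence.
Context (R : realType).
Implicit Types r : R.

Let clamp_proof r : Num.max 0 (Num.min 1 r) \in `[0, 1]%classic.
Proof.
by apply: mem_unit_interval; rewrite le_max lexx /= ge_max ler01 ge_min lexx.
Qed.

Let clamp r : unit_interval R :=
  exist (fun s : R => s \in `[0, 1]%classic) _ (clamp_proof r).

Let clamp_continuous : continuous clamp.
Proof.
apply: continuous_comp_initial => r.
apply: (@continuous_max _ _ (fun=> 0 : R^o)); first exact: cvg_cst.
by apply: (@continuous_min _ _ (fun=> 1 : R^o)); [exact: cvg_cst|exact: cvg_id].
Qed.

Let clamp0 r : r <= 0 -> clamp r = zero.
Proof.
move=> r0; apply/val_inj; rewrite /= min_r ?(le_trans r0)//.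
by rewrite max_l.
Qed.

Let clamp1 r : 1 <= r -> clamp r = one.
Proof. by move=> r1; apply/val_inj; rewrite /= min_l// max_r. Qed.

Let val0 : sval (zero : unit_interval R) = 0. Proof. by []. Qed.
Let val1 : sval (one : unit_interval R) = 1. Proof. by []. Qed.

Let val_continuous : continuous (fun s : unit_interval R => sval s).
Proof. exact: (@initial_continuous _ _ set_val). Qed.

Context (n : nat).
Local Notation cube := (unit_cube R n).

Let reparam (X : topologicalType) (a b : R)
    (H : cube * unit_interval R -> X) (p : cube * unit_interval R) : X :=
  H (p.1, clamp (a * sval p.2 + b)).

Let reparam_continuous (X : topologicalType) a b
    (H : cube * unit_interval R -> X) :
  continuous H -> continuous (reparam a b H).
Proof.
move=> cH p.
pose g (p : cube * unit_interval R) := clamp (a * sval p.2 + b).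
have cg : g q @[q --> p] --> g p.
  apply: (@continuous_comp _ _ _
    (fun p : cube * unit_interval R => a * sval p.2 + b) clamp);
    last exact: clamp_continuous.
  apply: cvgD; last exact: cvg_cst.
  apply: cvgM; first exact: cvg_cst.
  apply: (@continuous_comp _ _ _ snd (fun s : unit_interval R => sval s)).
    exact: cvg_snd.
  exact: val_continuous.
apply: (@continuous_comp _ _ _ (fun p => (p.1, g p)) H); last exact: cH.
exact: (@cvg_pair _ _ _ (nbhs p) (nbhs p.1) (nbhs (g p)) _ _ _ fst g
  cvg_fst cg).
Qed.

Context (X : topologicalType) (x : X).
Implicit Types f g h : hom_space R n x.

Lemma homotopic_refl f : homotopic f f.
Proof.
exists (fun p => hom_fun f p.1); split=> // p.
apply: (@continuous_comp _ _ _ fst (hom_fun f)); first exact: cvg_fst.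
exact: hom_fun_continuous.
Qed.

Lemma homotopic_sym f g : homotopic f g -> homotopic g f.
Proof.
move=> [H [cH H0 H1 Hb]]; exists (reparam (-1) 1 H); split.
- exact: reparam_continuous.
- by move=> t; rewrite /reparam val0 mulr0 add0r clamp1// H1.
- by move=> t; rewrite /reparam val1 mulr1 addNr clamp0// H0.
- by move=> t s bt; rewrite /reparam Hb// !hom_fun_boundary.
Qed.

Lemma homotopic_trans f g h :
  homotopic f g -> homotopic g h -> homotopic f h.
Proof.
move=> [H [cH H0 H1 Hb]] [K [cK K0 K1 Kb]].
pose A := [set p : cube * unit_interval R | sval p.2 <= 2^-1].
pose B := [set p : cube * unit_interval R | 2^-1 <= sval p.2].
pose H' := reparam 2 0 H; pose K' := reparam 2 (-1) K.
pose L (p : cube * unit_interval R) := if sval p.2 <= 2^-1 then H' p else K' p.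
have LH p : A p -> H' p = L p by rewrite /L /A /= => ->.
have LK p : B p -> K' p = L p.
  rewrite /L /B /= => Bp; case: ifPn => // Ap.
  have p2 : sval p.2 = 2^-1 by apply/eqP; rewrite eq_le Ap.
  rewrite /H' /K' /reparam p2 mulfV ?pnatr_eq0// addr0 subrr.
  by rewrite (clamp0 (lexx 0)) (clamp1 (lexx 1)) H1 K0.
have val2_continuous : continuous (fun p : cube * unit_interval R => sval p.2).
  move=> p; apply: (@continuous_comp _ _ _ snd
    (fun s : unit_interval R => sval s)); first exact: cvg_snd.
  exact: val_continuous.
have cA : closed A.
  exact: (preimage_closed (in1W val2_continuous) (@closed_le _ (2^-1 : R))).
have cB : closed B.
  exact: (preimage_closed (in1W val2_continuous) (@closed_ge _ (2^-1 : R))).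
exists L; split.
- apply/continuous_subspace_setT.
  have -> : [set: cube * unit_interval R] = A `|` B.
    apply/seteqP; split=> // p _; have [|/ltW] := leP (sval p.2) 2^-1.
      by left.
    by right.
  apply: withinU_continuous => //.
    apply: (@subspace_eq_continuous _ _ _ H'); last first.
      by apply: continuous_subspaceT; exact: reparam_continuous.
    by move=> p /set_mem/LH.
  apply: (@subspace_eq_continuous _ _ _ K'); last first.
    by apply: continuous_subspaceT; exact: reparam_continuous.
  by move=> p /set_mem/LK.
- move=> t; rewrite /L val0 ifT ?invr_ge0 ?ler0n//.
  by rewrite /H' /reparam val0 mulr0 addr0 clamp0// H0.
- move=> t; rewrite /L val1 ifF; last by apply/negbTE; rewrite -ltNge; lra.
  by rewrite /K' /reparam val1 mulr1 clamp1 ?K1//; lra.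
- move=> t s bt; rewrite /L; case: ifP => _; rewrite /H' /K' /reparam.
    by rewrite Hb.
  by rewrite Kb// !hom_fun_boundary.
Qed.

Definition homotopicb : rel (hom_space R n x) :=
  fun f g => `[< homotopic f g >].

Lemma homotopicb_refl : reflexive homotopicb.
Proof. by move=> f; apply/asboolP; exact: homotopic_refl. Qed.

Lemma homotopicb_sym : symmetric homotopicb.
Proof. by move=> f g; apply/asboolP/asboolP; exact: homotopic_sym. Qed.

Lemma homotopicb_trans : transitive homotopicb.
Proof.
move=> g f h /asboolP fg /asboolP gh.
by apply/asboolP; exact: homotopic_trans gh.
Qed.

Definition homotopic_equiv :=
  EquivRel homotopicb homotopicb_refl homotopicb_sym homotopicb_trans.

End homotopic_equivalence.

(* Only the underlying set of pi_n and its identity element, the class of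
   [cst_hom], are needed; the group law plays no role in the topology. *)
Definition homotopy_group (R : realType) (n : nat) (X : topologicalType)
  (x : X) : quotType (hom_space R n x) := {eq_quot @homotopic_equiv R n X x}.

Arguments homotopy_group R n {X} x.

Lemma homotopy_groupP (R : realType) (n : nat) (X : topologicalType) (x : X)
    (f g : hom_space R n x) :
  \pi_(homotopy_group R n x) f = \pi_(homotopy_group R n x) g <->
  homotopic f g.
Proof.
have piP := @eqmodP _ (@homotopic_equiv R n X x) f g.
by split=> [/piP/asboolP//|fg]; apply/piP/asboolP.
Qed.

Definition top_homotopy_group (R : realType) (n : nat) (X : topologicalType)
  (x : X) : topologicalType := quotient_topology (homotopy_group R n x).

Arguments top_homotopy_group R n {X} x.

Section induced_map.
Context (R : realType) (n : nat) (Y Z : topologicalType) (phi : Y -> Z)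
  (phi_cts : continuous phi) (y : Y).

Let comp_cts (f : hom_space R n y) : continuous (phi \o hom_fun f).
Proof.
move=> t; apply: (@continuous_comp _ _ _ (hom_fun f) phi).
  exact: hom_fun_continuous.
exact: phi_cts.
Qed.

Let comp_boundary (f : hom_space R n y) t :
  cube_boundary R n t -> (phi \o hom_fun f) t = phi y.
Proof. by move=> bt /=; rewrite hom_fun_boundary. Qed.

Definition hom_comp (f : hom_space R n y) : hom_space R n (phi y) :=
  mk_hom (@comp_cts f) (@comp_boundary f).

Definition homotopy_group_map (c : homotopy_group R n y) :
    homotopy_group R n (phi y) :=
  \pi_(homotopy_group R n (phi y)) (hom_comp (repr c)).

End induced_map.

Lemma homotopy_group_mapE (R : realType) (n : nat) (Y Z : topologicalType)
    (phi : Y -> Z) (phi_cts : continuous phi) (y : Y) (f : hom_space R n y) :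
  homotopy_group_map phi_cts (\pi_(homotopy_group R n y) f) =
  \pi_(homotopy_group R n (phi y)) (hom_comp phi_cts f).
Proof.
apply/homotopy_groupP.
have /homotopy_groupP[H [cH H0 H1 Hb]] :=
  reprK (\pi_(homotopy_group R n y) f).
exists (phi \o H); split=> /=.
- move=> p; apply: (@continuous_comp _ _ _ H phi); first exact: cH.
  exact: phi_cts.
- by move=> t; rewrite H0.
- by move=> t; rewrite H1.
- by move=> t s bt; rewrite Hb.
Qed.

Definition set_incl (X : Type) (V U : set X) (VU : V `<=` U) (v : V) : U :=
  exist _ (sval v) (mem_set (VU _ (set_mem (svalP v)))).

Lemma set_incl_continuous (X : topologicalType) (V U : set X)
  (VU : V `<=` U) : continuous (set_incl VU).
Proof.
apply: continuous_comp_initial => v.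
exact: (@initial_continuous _ _ (@set_val _ V)).
Qed.

(* The clause on paths is the case k = 0: any two points of V lie in the same
   path component of U. *)
Definition locally_n_connected (R : realType) (n : nat)
    (X : topologicalType) : Prop :=
  forall (x : X) (U : set X), nbhs x U ->
    exists (V : set X) (VU : V `<=` U),
      [/\ nbhs x V,
          forall v w : V,
            inhabited {path unit_interval R from set_incl VU v to set_incl VU w} &
          forall (k : nat) (v : V), (1 <= k <= n)%N ->
            forall c : homotopy_group R k v,
              homotopy_group_map (@set_incl_continuous _ _ _ VU) c =
              \pi_(homotopy_group R k (set_incl VU v))
                (cst_hom R k (set_incl VU v))].

(* Main.v *)
Require Import Defs.
From mathcomp Require Import all_boot all_order all_algebra generic_quotient.
From mathcomp Require Import all_classical all_reals all_analysis.
From mathcomp Require Import homotopy lra.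

Set Implicit Arguments.
Unset Strict Implicit.
Unset Printing Implicit Defensive.

Import Order.TTheory GRing.Theory Num.Theory.
Import numFieldNormedType.Exports.

Local Open Scope classical_set_scope.
Local Open Scope ring_scope.
Local Open Scope quotient_scope.

(** Since the topology on the homotopy group is the quotient topology,
    discreteness means that every homotopy class is open: a map [g]
    sufficiently close to [f] is homotopic to [f] relative to the boundary of
    the cube. As the cube is compact and X is metric, the compact-open topology
    is that of uniform convergence ([near_hom_fun]), so it must be shown that
    uniformly close maps are homotopic ([near_homotopic]).

    A homotopy from [f] to [g] is an extension, to the (n+1)-cube (time) x
    (n-cube), of a map given on its boundary: [f] and [g] on the two ends, the
    base point on the sides. That boundary map is uniformly close to (s, t) |->
    f(t). If f(t) were constant, local n-connectedness would provide the
    extension, as a map of a k-sphere, k <= n, into a small ball extends over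
    the (k+1)-disc within a larger ball that is still small. In general the
    cube must be subdivided so finely that [f] is almost constant on each
    piece.

    The subdivision treats one coordinate at a time. The notion [fillable]
    concerns a product of a block [D], with boundary [A], by an m-cube, and a
    control map [f] of the m-cube: boundary maps close to [f] extend to maps
    close to [f], with a modulus that does not depend on [f] as long as [f]
    takes values in a fixed compact set. To pass from m to m+1
    ([fillable_cut]), cut the last coordinate into slabs so thin that [f]
    hardly varies across a slab. First fill the walls between slabs, which are
    products of [D] by an m-cube; then fill the slabs. On a slab [f] is nearly
    independent of the last coordinate, which therefore may be moved into the
    block: a slab is a product of [D] x [0, 1] by an m-cube. Starting from the
    case m = 0, where [D] is a cube of dimension at most n+1, this reaches m =
    n with [D] the time interval. The walls must be filled closely enough for
    the slabs that follow; as the moduli do not depend on [f], they can be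
    chosen before the number of slabs.

    The case m = 0 asks for an extension over a (j+1)-cube of a map given on
    its boundary ([locally_fill]), uniformly for centres in a compact set
    ([uniform_fill]). For j = 0 this is a path. For j > 0 the hypothesis speaks
    of maps of the j-cube that are constant on its boundary; the map
    [cell_wrap] wraps the j-cube around the boundary of the (j+1)-cube and
    collapses its own boundary to a point, and [cone_wrap] exhibits the
    (j+1)-cube as the quotient of the cylinder over the j-cube through which
    the null-homotopy factors ([sphere_fill]). *)

(** * Continuous maps and their pasting *)

Section continuity.
Context {S T U : topologicalType}.

Lemma comp_cts (f : S -> T) (g : T -> U) :
  continuous f -> continuous g -> continuous (fun x => g (f x)).
Proof.
by move=> cf cg x; apply: (@continuous_comp _ _ _ f g); [exact: cf|exact: cg].
Qed.

Lemma pair_cts (f : S -> T) (g : S -> U) :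
  continuous f -> continuous g -> continuous (fun x => (f x, g x)).
Proof. by move=> cf cg x; apply: cvg_pair; [exact: cf|exact: cg]. Qed.

Lemma fst_cts : continuous (fun z : T * U => z.1).
Proof. by move=> z; exact: cvg_fst. Qed.

Lemma snd_cts : continuous (fun z : T * U => z.2).
Proof. by move=> z; exact: cvg_snd. Qed.

Lemma within_comp (f : S -> T) (g : T -> U) (A : set S) (B : set T) :
  continuous f -> (forall x, A x -> B (f x)) -> {within B, continuous g} ->
  {within A, continuous (fun x => g (f x))}.
Proof.
move=> cf AB /subspace_continuousP cg; apply/subspace_continuousP => x Ax.
move=> W Wg; have H := cf x _ (cg _ (AB _ Ax) _ Wg).
move: H; rewrite /within /nbhs /= => H.
by apply: (filterS _ H) => y /= Hy Ay; apply: Hy; exact: AB.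
Qed.

End continuity.

Lemma within_setT_cts {S T : topologicalType} (f : S -> T) (A : set S) :
  (forall x, A x) -> {within A, continuous f} -> continuous f.
Proof.
move=> AT; have -> : A = setT by apply/seteqP; split.
by move=> cf; apply/continuous_subspace_setT.
Qed.

Lemma within_eq {S T : topologicalType} (f g : S -> T) (A : set S) :
  (forall x, A x -> f x = g x) -> {within A, continuous f} ->
  {within A, continuous g}.
Proof. by move=> fg; apply: subspace_eq_continuous => x /set_mem; exact: fg. Qed.

Lemma closed_le_cts {S : topologicalType} {R : realType} (f : S -> R) (r : R) :
  continuous f -> closed [set x | f x <= r].
Proof. by move=> cf; exact: (preimage_closed (in1W cf) (@closed_le _ r)). Qed.

Lemma closed_ge_cts {S : topologicalType} {R : realType} (f : S -> R) (r : R) :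
  continuous f -> closed [set x | r <= f x].
Proof. by move=> cf; exact: (preimage_closed (in1W cf) (@closed_ge _ r)). Qed.

Lemma closed_eq_cts {S : topologicalType} {R : realType} (f : S -> R) (r : R) :
  continuous f -> closed [set x | f x = r].
Proof. by move=> cf; exact: (preimage_closed (in1W cf) (@closed_eq _ r)). Qed.

Lemma glue_cts {S T : topologicalType} {R : realType} (c : S -> R) (r : R)
    (f g : S -> T) : continuous c -> continuous f -> continuous g ->
  (forall x, c x = r -> f x = g x) ->
  continuous (fun x => if c x <= r then f x else g x).
Proof.
move=> cc cf cg fg.
pose A := [set x | c x <= r]; pose B := [set x | r <= c x].
apply: (@within_setT_cts _ _ _ (A `|` B)).
  by move=> x; rewrite /A /B /=; have [|/ltW] := leP (c x) r; [left|right].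
apply: withinU_continuous.
- exact: closed_le_cts.
- exact: closed_ge_cts.
- apply: (within_eq (f := f)); last exact: continuous_subspaceT.
  by move=> x; rewrite /A /= => ->.
- apply: (within_eq (f := g)); last exact: continuous_subspaceT.
  move=> x; rewrite /B /= => rc; case: ifPn => // cr.
  by apply/esym/fg/eqP; rewrite eq_le cr.
Qed.

Section real_valued.
Context {S : topologicalType} {R : realType}.
Implicit Types f g : S -> R.

Lemma addr_cts f g :
  continuous f -> continuous g -> continuous (fun x => f x + g x).
Proof. by move=> cf cg x; apply: continuousD; [exact: cf|exact: cg]. Qed.

Lemma mulr_cts f g :
  continuous f -> continuous g -> continuous (fun x => f x * g x).
Proof. by move=> cf cg x; apply: continuousM; [exact: cf|exact: cg]. Qed.

Lemma oppr_cts f : continuous f -> continuous (fun x => - f x).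
Proof. by move=> cf x; apply: continuousN; exact: cf. Qed.

Lemma invr_cts f :
  (forall x, f x != 0) -> continuous f -> continuous (fun x => (f x)^-1).
Proof. by move=> f0 cf x; apply: continuousV; [exact: f0|exact: cf]. Qed.

Lemma maxr_cts f g :
  continuous f -> continuous g -> continuous (fun x => Num.max (f x) (g x)).
Proof. by move=> cf cg x; apply: continuous_max; [exact: cf|exact: cg]. Qed.

Lemma minr_cts f g :
  continuous f -> continuous g -> continuous (fun x => Num.min (f x) (g x)).
Proof. by move=> cf cg x; apply: continuous_min; [exact: cf|exact: cg]. Qed.

End real_valued.

(** * The unit interval and its powers *)

Section interval.
Context {R : realType}.
Local Notation I := (unit_interval R).

Lemma clampI_mem (r : R) : Num.max 0 (Num.min 1 r) \in `[0, 1]%classic.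
Proof.
by apply: mem_unit_interval; rewrite le_max lexx /= ge_max ler01 ge_min lexx.
Qed.

Definition clampI (r : R) : I :=
  exist (fun s : R => s \in `[0, 1]%classic) _ (clampI_mem r).

Lemma clampI_cts : continuous clampI.
Proof.
apply: continuous_comp_initial.
apply: maxr_cts; first exact: cst_continuous.
by apply: minr_cts; [exact: cst_continuous|move=> r; exact: cvg_id].
Qed.

Lemma svalI_cts : continuous (fun s : I => sval s).
Proof. exact: (@initial_continuous _ _ set_val). Qed.

Lemma svalI_itv (s : I) : 0 <= sval s <= 1.
Proof. by case: s => s /= /set_mem; rewrite /= in_itv. Qed.

Lemma svalI_inj (s t : I) : sval s = sval t -> s = t.
Proof. by move=> /val_inj. Qed.

Lemma sval_zero : sval (zero : I) = 0. Proof. by []. Qed.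
Lemma sval_one : sval (one : I) = 1. Proof. by []. Qed.

Lemma sval_clampI (r : R) : 0 <= r <= 1 -> sval (clampI r) = r.
Proof. by move=> /andP[r0 r1]; rewrite /= min_r// max_r. Qed.

Lemma clampI_sval (s : I) : clampI (sval s) = s.
Proof. by apply: svalI_inj; apply: sval_clampI; exact: svalI_itv. Qed.

Lemma clampI_le0 (r : R) : r <= 0 -> clampI r = zero.
Proof.
by move=> r0; apply: svalI_inj; rewrite /= min_r ?(le_trans r0)// max_l.
Qed.

Lemma clampI_ge1 (r : R) : 1 <= r -> clampI r = one.
Proof. by move=> r1; apply: svalI_inj; rewrite /= min_l// max_r. Qed.

(** The m-cube as an iterated product, so that its last coordinate can be split
    off by projection; the empty row vectors serve as the one-point space. *)
Fixpoint cell (m : nat) : topologicalType :=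
  if m is m'.+1 then ((cell m' * I)%type : topologicalType) else 'rV[R]_0.

Fixpoint cell_bd (m : nat) : set (cell m) :=
  if m is m'.+1 return set (cell m) then
    [set z | cell_bd z.1 \/ z.2 = zero \/ z.2 = one]
  else set0.

Fixpoint cell_coord (m : nat) : cell m -> nat -> R :=
  if m is m'.+1 return cell m -> nat -> R then
    fun z i => if i == m' then sval z.2 else cell_coord z.1 i
  else fun _ _ => 0.

(** Coordinates are indexed by all natural numbers, to avoid dependent indices;
    they are clamped to the interval, which makes this map total. *)
Fixpoint mk_cell (m : nat) (u : nat -> R) : cell m :=
  if m is m'.+1 return cell m then (mk_cell m' u, clampI (u m')) else 0.

Lemma cell_coord_cts m i : continuous (fun z : cell m => cell_coord z i).
Proof.
elim: m => [|m IH] /=; first by move=> z; exact: cst_continuous.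
case: eqP => _; first exact: comp_cts (@snd_cts _ _) svalI_cts.
exact: comp_cts (@fst_cts _ _) IH.
Qed.

Lemma mk_cell_cts (T : topologicalType) m (u : T -> nat -> R) :
  (forall i, (i < m)%N -> continuous (fun t => u t i)) ->
  continuous (fun t => mk_cell m (u t)).
Proof.
elim: m => [|m IH] cu /=; first by move=> z; exact: cst_continuous.
apply: pair_cts; first by apply: IH => i im; apply: cu; exact: ltnW.
apply: comp_cts clampI_cts; exact: cu.
Qed.

Lemma cell_coord_itv m (z : cell m) i : 0 <= cell_coord z i <= 1.
Proof.
elim: m z => [|m IH] z /=; first by rewrite lexx ler01.
by case: eqP => _; [exact: svalI_itv|exact: IH].
Qed.

Lemma cell_coord_mk m u i : (i < m)%N -> 0 <= u i <= 1 ->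
  cell_coord (mk_cell m u) i = u i.
Proof.
elim: m => [//|m IH] im ui /=; case: eqP => [<-|/eqP nim].
  exact: sval_clampI.
by apply: IH => //; rewrite ltn_neqAle nim.
Qed.

Lemma cell_eq m (z w : cell m) :
  (forall i, (i < m)%N -> cell_coord z i = cell_coord w i) -> z = w.
Proof.
elim: m z w => [|m IH]; first by move=> z w _; rewrite [z]thinmx0 [w]thinmx0.
move=> [z s] [w t] /= zw; congr pair.
  by apply: IH => i im; have := zw i (ltnW im); rewrite (ltn_eqF im).
by apply: svalI_inj; have := zw m (leqnn _); rewrite eqxx.
Qed.

Lemma cell_bdP m (z : cell m) : cell_bd z <->
  exists2 i, (i < m)%N & cell_coord z i = 0 \/ cell_coord z i = 1.
Proof.
elim: m z => [|m IH] z /=; first by split=> // -[].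
split=> [[/IH[i im zi]|zs]|[i]].
- by exists i; [exact: ltnW|rewrite (ltn_eqF im)].
- exists m => //; rewrite eqxx.
  by case: zs => ->; rewrite ?sval_zero ?sval_one; [left|right].
rewrite ltnS leq_eqVlt => /orP[/eqP ->|im].
  rewrite eqxx => zs; right.
  by case: zs => zs; [left|right]; apply: svalI_inj.
rewrite (ltn_eqF im) => zi; left; apply/IH; by exists i.
Qed.

Lemma fiber_closed (T : topologicalType) (c : T -> I) (s : I) :
  continuous c -> closed [set x | c x = s].
Proof.
move=> cc; have -> : [set x | c x = s] = [set x | sval (c x) = sval s].
  by apply/seteqP; split=> x /=; [move=> ->|exact: svalI_inj].
exact: closed_eq_cts (comp_cts cc svalI_cts).
Qed.

Lemma one_eq_zero : (one : I) == zero = false.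
Proof. by apply/eqP => /(congr1 sval)/eqP; rewrite oner_eq0. Qed.

(** The pasting lemma in the form used for boundary maps of a cylinder: one map
    on each end and a third one on the sides, where [c] is the height. *)
Lemma glue_ends_cts {S T : topologicalType} (A : set S) (c : S -> I)
    (f0 f1 f : S -> T) : closed A -> continuous c ->
  continuous f0 -> continuous f1 -> {within A, continuous f} ->
  (forall x, A x -> c x = zero -> f0 x = f x) ->
  (forall x, A x -> c x = one -> f1 x = f x) ->
  {within A `|` ([set x | c x = zero] `|` [set x | c x = one]),
    continuous (fun x => if c x == zero then f0 x else
                         if c x == one then f1 x else f x)}.
Proof.
move=> cA cc cf0 cf1 cf f0E f1E.
pose g x := if c x == zero then f0 x else if c x == one then f1 x else f x.
apply: (@withinU_continuous _ _ _ _ g) => //.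
- by apply: closedU; exact: fiber_closed.
- apply: (@within_eq _ _ f g) => // x Ax; rewrite /g /=.
  have [x0|_] := eqVneq (c x) zero; first by rewrite f0E.
  by have [x1|//] := eqVneq (c x) one; rewrite f1E.
- apply: withinU_continuous; try exact: fiber_closed.
  + apply: (@within_eq _ _ f0 g); last exact: continuous_subspaceT.
    by move=> x; rewrite /g /= => ->; rewrite eqxx.
  + apply: (@within_eq _ _ f1 g); last exact: continuous_subspaceT.
    by move=> x; rewrite /g /= => ->; rewrite one_eq_zero eqxx.
Qed.

Lemma cell_bd_closed m : closed (@cell_bd m).
Proof.
elim: m => [|m IH] /=; first exact: closed0.
have -> : [set z : cell m * I | cell_bd z.1 \/ z.2 = zero \/ z.2 = one] =
    fst @^-1` @cell_bd m `|` ([set z | z.2 = zero] `|` [set z | z.2 = one]).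
  by [].
apply: closedU; last by apply: closedU; exact: fiber_closed (@snd_cts _ _).
by apply: preimage_closed IH; exact: in1W (@fst_cts _ _).
Qed.

Lemma interval_compact : compact [set: I].
Proof.
have -> : [set: I] = clampI @` `[0, 1]%classic.
  apply/seteqP; split=> // s _; exists (sval s); last exact: clampI_sval.
  by rewrite /= in_itv /= svalI_itv.
apply: continuous_compact (@segment_compact _ _ _).
exact: continuous_subspaceT clampI_cts.
Qed.

Lemma cell_compact m : compact [set: cell m].
Proof.
elim: m => [|m IH] /=.
  have -> : [set: 'rV[R]_0] = [set 0].
    by apply/seteqP; split=> // z _; rewrite [z]thinmx0.
  exact: compact_set1.
by rewrite -setXTT; apply: compact_setX => //; exact: interval_compact.
Qed.

Lemma cell_hausdorff m : hausdorff_space (cell m).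
Proof.
move=> z w zw; apply: cell_eq => i _.
apply: (@Rhausdorff R) => A B Az Bw.
have coord_cts := @cell_coord_cts m i.
have [y [Ay By]] := zw _ _ (coord_cts z _ Az) (coord_cts w _ Bw).
by exists (cell_coord y i).
Qed.

End interval.
Arguments cell : clear implicits.

(** * Extending maps by cutting a cube into slabs *)

Section fill.
Context {R : realType} {X : pseudoMetricType R}.
Local Notation I := (unit_interval R).

(** Shifting the last coordinate by [r] is jointly continuous in the point and
    [r] and is the identity at [r = 0]; compactness of the cube makes the
    smallness of [r] uniform in the point. *)
Lemma uniform_cts_last m (f : cell R m * I -> X) (d : R) : continuous f -> 0 < d ->
  exists2 N : nat, (0 < N)%N & forall l (s t : I),
    `|sval s - sval t| <= N%:R^-1 -> ball (f (l, s)) d (f (l, t)).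
Proof.
move=> cf d0.
pose sh (p : (cell R m * I) * R) : cell R m * I :=
  (p.1.1, clampI (sval p.1.2 + p.2)).
have csh : continuous sh.
  apply: pair_cts; first exact: comp_cts (@fst_cts _ _) (@fst_cts _ _).
  apply: comp_cts clampI_cts; apply: addr_cts (@snd_cts _ _).
  exact: (comp_cts (comp_cts (@fst_cts _ _) (@snd_cts _ _)) svalI_cts).
have cpt : compact [set: cell R m * I] by exact: (@cell_compact R m.+1).
have := (iffLR (compact_near_coveringP _) cpt) R (nbhs (0 : R))
  (fun r z => ball (f z) d (f (sh (z, r)))) _.
case.
- move=> z _.
  have d20 : 0 < d / 2 by rewrite divr_gt0.
  have shz : sh (z, 0) = z.
    by rewrite /sh /= addr0 clampI_sval; case: z.
  have n1 : \forall p \near (z, (0 : R)), ball (f z) (d / 2) (f p.1).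
    apply: (comp_cts (@fst_cts (cell R m * I)%type R) cf) => /=.
    exact: nbhsx_ballx.
  have n2 : \forall p \near (z, (0 : R)), ball (f z) (d / 2) (f (sh p)).
    have := comp_cts csh cf; move/(_ (z, 0)); apply; rewrite shz.
    exact: nbhsx_ballx.
  apply: filterS2 n1 n2 => -[z' r] /= b1 b2.
  by apply: (@ball_splitr _ _ (f z)).
move=> eta /= eta0 H.
have [N] := near_infty_natSinv_lt (PosNum eta0).
move=> _ /(_ N (leqnn N)) /= HN; exists N.+1 => // l s t st.
have := H (sval t - sval s); rewrite /ball_ /= sub0r normrN distrC.
move=> /(_ (le_lt_trans st HN) (l, s) Logic.I).
by rewrite /sh /= addrC subrK clampI_sval.
Qed.

(** The boundary of the cylinder over a pair ([D], [A]); by definition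
    [cell_bd] in dimension m+1 is [cyl_bd] of [cell_bd] in dimension m. *)
Definition cyl_bd {D : Type} (A : set D) : set (D * I) :=
  [set z | A z.1 \/ z.2 = zero \/ z.2 = one].

Definition prod_bd {D : Type} (A : set D) m : set (D * cell R m) :=
  [set z | A z.1 \/ @cell_bd R m z.2].

(** The coordinates of [D] are those along which the boundary map hardly
    varies, and [f] depends on the others only. It is essential that [d]
    precedes [f]: the tolerances are fixed before the fineness of the
    subdivision, which depends on the modulus of continuity of [f]. *)
Definition fills (K : set X) m (D : topologicalType) (A : set D) (d e : R) :=
  forall (f : cell R m -> X) (h : D * cell R m -> X),
    continuous f -> (forall l, K (f l)) ->
    {within prod_bd A (m := m), continuous h} ->
    (forall z, prod_bd A z -> ball (f z.2) d (h z)) ->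
    exists H : D * cell R m -> X,
      [/\ continuous H, forall z, prod_bd A z -> H z = h z &
          forall z, ball (f z.2) e (H z)].

Definition fillable (K : set X) m (D : topologicalType) (A : set D) :=
  forall e : R, 0 < e -> exists2 d : R, 0 < d & fills K m A d e.

Section cut.
Context {m : nat} {D : topologicalType} (A : set D) (cA : closed A).
Variables (f : cell R m * I -> X) (h : D * (cell R m * I) -> X).
Local Notation B := (prod_bd A (m := m.+1)).

(** [W] is the section, at the value [t] of the last coordinate, of the
    extension to be built. At the two end values the section is dictated by
    [h]. *)
Definition is_wall (w : R) (t : I) (W : D * cell R m -> X) :=
  [/\ continuous W,
      forall z, B (z.1, (z.2, t)) -> W z = h (z.1, (z.2, t)) &
      forall z, ball (f (z.2, t)) w (W z)].

Hypotheses (cf : continuous f) (ch : {within B, continuous h}).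

Lemma wall_exists (K : set X) w d (t : I) :
  (forall l, K (f l)) ->
  d <= w ->
  fills K m A d w ->
  (forall z, B z -> ball (f z.2) d (h z)) ->
  exists W, is_wall w t W.
Proof.
move=> Kf dw fill hf.
pose sl (z : D * cell R m) : D * (cell R m * I) := (z.1, (z.2, t)).
have csl : continuous sl.
  apply: pair_cts; first exact: fst_cts.
  by apply: pair_cts; [exact: snd_cts|exact: cst_continuous].
have [tE|tNE] := pselect (t = zero \/ t = one).
  have slB z : B (sl z) by right; right.
  exists (h \o sl); split=> //.
    apply: (@within_setT_cts _ _ _ setT) => //.
    exact: within_comp csl _ ch.
  by move=> z; apply: le_ball dw _ _; exact: (hf (sl z)).
have slB z : prod_bd A z -> B (sl z).
  by move=> [Az|lz]; [left|right; left].
have [||||H [cH Hh Hf]] := fill (fun l => f (l, t)) (h \o sl).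
- apply: comp_cts cf; apply: pair_cts; first by move=> l; exact: cvg_id.
  exact: cst_continuous.
- by move=> l; exact: Kf.
- exact: within_comp csl slB ch.
- by move=> z /slB /hf.
exists H; split => // z [Az|[lz|tE]]; first by apply: Hh; left.
  by apply: Hh; right.
by case: tNE.
Qed.

Variable N : nat.
Hypothesis N0 : (0 < N)%N.
Let NR0 : 0 < N%:R :> R. Proof. by rewrite ltr0n. Qed.

(** The parameter at height [s] of the slab number [k], out of [N]. *)
Definition cut_at (k : nat) (s : R) : I := clampI ((k%:R + s) / N%:R).

Lemma cut_at_cts k : continuous (fun s : I => cut_at k (sval s)).
Proof.
apply: comp_cts clampI_cts.
apply: mulr_cts; last exact: cst_continuous.
by apply: addr_cts; [exact: cst_continuous|exact: svalI_cts].
Qed.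

Lemma cut_atE k (t : I) : cut_at k (N%:R * sval t - k%:R) = t.
Proof. by rewrite /cut_at addrC subrK mulrC mulKf ?gt_eqF// clampI_sval. Qed.

Lemma sval_cut_at k : (k <= N)%N -> sval (cut_at k 0) = k%:R / N%:R.
Proof.
move=> kN; rewrite /cut_at addr0 sval_clampI// divr_ge0//=.
by rewrite ler_pdivrMr// mul1r ler_nat.
Qed.

(** On the slab the control map is replaced by its value at the bottom of the
    slab, so that the last coordinate becomes a coordinate of the block; half
    of the tolerance [d1] pays for this, the other half for the walls and the
    given boundary map. *)
Lemma slab_exists (K : set X) w d1 e k (W : I -> D * cell R m -> X) :
  (forall l, K (f l)) ->
  fills K m (cyl_bd A) d1 e ->
  (forall t, is_wall w t (W t)) -> w <= d1 / 2 ->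
  (forall z, B z -> ball (f z.2) (d1 / 2) (h z)) ->
  (forall l (s t : I), `|sval s - sval t| <= N%:R^-1 ->
     ball (f (l, s)) (d1 / 2) (f (l, t))) ->
  0 < d1 -> (k < N)%N ->
  exists G : (D * I) * cell R m -> X,
    [/\ continuous G,
        forall d l, G ((d, zero), l) = W (cut_at k 0) (d, l),
        forall d l, G ((d, one), l) = W (cut_at k.+1 0) (d, l),
        forall d l s, prod_bd A (d, l) ->
          G ((d, s), l) = h (d, (l, cut_at k (sval s))) &
        forall z, ball (f (z.2, cut_at k 0)) e (G z)].
Proof.
move=> Kf fill HW wd1 hf osc d10 kN.
have cut0 : cut_at k (sval (zero : I)) = cut_at k 0 by [].
have cut1 : cut_at k (sval (one : I)) = cut_at k.+1 0.
  by rewrite /cut_at sval_one addr0 -natr1.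
pose g (z : (D * I) * cell R m) : X :=
  if z.1.2 == zero then W (cut_at k 0) (z.1.1, z.2) else
  if z.1.2 == one then W (cut_at k.+1 0) (z.1.1, z.2) else
  h (z.1.1, (z.2, cut_at k (sval z.1.2))).
have dlB d l t : prod_bd A (d, l) -> B (d, (l, t)).
  by case=> [?|?]; [left|right; left].
have wall0 d l : prod_bd A (d, l) ->
    W (cut_at k 0) (d, l) = h (d, (l, cut_at k 0)).
  by move=> dl; have [_ -> //] := HW (cut_at k 0); exact: dlB.
have wall1 d l : prod_bd A (d, l) ->
    W (cut_at k.+1 0) (d, l) = h (d, (l, cut_at k.+1 0)).
  by move=> dl; have [_ -> //] := HW (cut_at k.+1 0); exact: dlB.
have gE d s l : prod_bd A (d, l) -> g ((d, s), l) = h (d, (l, cut_at k (sval s))).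
  move=> dl; rewrite /g /=; case: eqP => [->|_]; first exact: wall0.
  by case: eqP => [->|//]; rewrite cut1; exact: wall1.
have cdl : continuous (fun z : (D * I) * cell R m => (z.1.1, z.2)).
  apply: pair_cts; last exact: snd_cts.
  exact: comp_cts (@fst_cts _ _) (@fst_cts _ _).
have cs : continuous (fun z : (D * I) * cell R m => z.1.2).
  exact: comp_cts (@fst_cts _ _) (@snd_cts _ _).
have [||||H [cH Hg Hf]] := fill (fun l => f (l, cut_at k 0)) g.
- apply: comp_cts cf; apply: pair_cts; first by move=> l; exact: cvg_id.
  exact: cst_continuous.
- by move=> l; exact: Kf.
- have -> : prod_bd (cyl_bd A) (m := m) =
      [set z | prod_bd A (z.1.1, z.2)] `|`
      ([set z | z.1.2 = zero] `|` [set z | z.1.2 = one]).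
    apply/seteqP; split=> -[[d s] l]; rewrite /prod_bd /cyl_bd /=; tauto.
  apply: glue_ends_cts => //.
  + apply: (@closedU _ [set z | A z.1.1] [set z | cell_bd z.2]).
      apply: (preimage_closed _ cA).
      exact: in1W (comp_cts (@fst_cts _ _) (@fst_cts _ _)).
    by apply: (preimage_closed _ (@cell_bd_closed R m)); exact: in1W (@snd_cts _ _).
  + by apply: comp_cts cdl _; have [] := HW (cut_at k 0).
  + by apply: comp_cts cdl _; have [] := HW (cut_at k.+1 0).
  + apply: (within_comp _ _ ch); last by move=> z; exact: dlB.
    apply: pair_cts; first exact: comp_cts (@fst_cts _ _) (@fst_cts _ _).
    by apply: pair_cts; [exact: snd_cts|exact: comp_cts cs (@cut_at_cts k)].
  + by move=> z bz z0; rewrite z0; exact: wall0.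
  + by move=> z bz z1; rewrite z1 cut1; exact: wall1.
- move=> [[d s] l] /= bz.
  have near_cut (s' : I) :
      ball (f (l, cut_at k 0)) (d1 / 2) (f (l, cut_at k (sval s'))).
    apply: osc; rewrite sval_cut_at ?(ltnW kN)//.
    have /andP[s0 s1] := svalI_itv s'.
    rewrite -/(clampI _) sval_clampI.
      rewrite -mulrBl normrM [`|N%:R^-1|]ger0_norm ?invr_ge0 ?(ltW NR0)//.
      rewrite ler_piMl ?invr_ge0 ?(ltW NR0)// ler_norml; apply/andP; split; lra.
    rewrite divr_ge0 ?addr_ge0 ?(ltW NR0)//= ler_pdivrMr// mul1r.
    have : k.+1%:R <= N%:R :> R by rewrite ler_nat.
    by rewrite -natr1; lra.
  apply: (@ball_split _ _ (f (l, cut_at k (sval s)))); first exact: near_cut.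
  have wall t : ball (f (l, t)) (d1 / 2) (W t (d, l)).
    by have [_ _ /(_ (d, l)) Wf] := HW t; apply: le_ball wd1 _ Wf.
  rewrite /g /=; case: eqP => [->|s0]; first exact: wall.
  case: eqP => [->|s1]; first by rewrite cut1; exact: wall.
  apply: (hf (d, (l, _))); case: bz => [[?|[]]|] //; first by left.
  by move=> ?; right; left.
exists H; split => //.
- by move=> d l; rewrite Hg /g ?eqxx//; left; right; left.
- by move=> d l; rewrite Hg /g /= ?one_eq_zero ?eqxx//; left; right; right.
- move=> d l s dl; rewrite Hg ?gE//.
  by case: dl => /= ?; [left; left|right].
Qed.

(** Stacks the first [k] slabs. Above them the map is extended by the last
    wall, constantly in the last coordinate, so that the next slab can be
    pasted to a map defined on the whole product. *)
Lemma slabs_glue (K : set X) w d1 e k (W : I -> D * cell R m -> X) :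
  (forall l, K (f l)) -> fills K m (cyl_bd A) d1 (e / 2) ->
  (forall t, is_wall w t (W t)) -> w <= d1 / 2 -> w <= e -> 0 < d1 ->
  (forall z, B z -> ball (f z.2) (d1 / 2) (h z)) ->
  (forall l (s t : I), `|sval s - sval t| <= N%:R^-1 ->
     ball (f (l, s)) (d1 / 2) (f (l, t)) /\
     ball (f (l, s)) (e / 2) (f (l, t))) ->
  (k <= N)%N ->
  exists H : D * (cell R m * I) -> X,
    [/\ continuous H,
        forall z : D * (cell R m * I), k%:R <= N%:R * sval z.2.2 ->
          H z = W (cut_at k 0) (z.1, z.2.1),
        forall z : D * (cell R m * I), N%:R * sval z.2.2 <= k%:R ->
          ball (f z.2) e (H z) &
        forall z : D * (cell R m * I), N%:R * sval z.2.2 <= k%:R ->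
          B z -> H z = h z].
Proof.
move=> Kf fill HW wd1 we d10 hf osc.
have cdl : continuous (fun z : D * (cell R m * I) => (z.1, z.2.1)).
  apply: pair_cts; first exact: fst_cts.
  exact: comp_cts (@snd_cts _ _) (@fst_cts _ _).
have ct : continuous (fun z : D * (cell R m * I) => sval z.2.2).
  exact: comp_cts (comp_cts (@snd_cts _ _) (@snd_cts _ _)) svalI_cts.
have cNt : continuous (fun z : D * (cell R m * I) => N%:R * sval z.2.2).
  by apply: mulr_cts ct; exact: cst_continuous.
elim: k => [_|k IH kN].
  have first_wall (z : D * (cell R m * I)) :
      N%:R * sval z.2.2 <= 0%:R -> z.2.2 = cut_at 0 0.
    rewrite pmulr_rle0// => t0; apply: svalI_inj; rewrite sval_cut_at// mul0r.
    by apply/eqP; rewrite eq_le t0; case/andP: (svalI_itv z.2.2).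
  have [cW Wh Wf] := HW (cut_at 0 0).
  exists (fun z => W (cut_at 0 0) (z.1, z.2.1)); split => //.
  - exact: comp_cts cdl cW.
  - move=> [d [l t]] /first_wall /= ->; apply: le_ball we _ _.
    exact: (Wf (d, l)).
  - by move=> [d [l t]] /first_wall /= -> Bz; rewrite Wh.
have [H [cH HWk Hf Hh]] := IH (ltnW kN).
have [|G [cG G0 G1 Gh Gf]] := slab_exists Kf fill HW wd1 hf _ d10 kN.
  by move=> l s t /(osc l)[].
pose sh (z : D * (cell R m * I)) : (D * I) * cell R m :=
  ((z.1, clampI (N%:R * sval z.2.2 - k%:R)), z.2.1).
have csh : continuous sh.
  apply: pair_cts; last exact: comp_cts (@snd_cts _ _) (@fst_cts _ _).
  apply: pair_cts; first exact: fst_cts.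
  apply: comp_cts clampI_cts; apply: addr_cts cNt _; exact: cst_continuous.
exists (fun z => if N%:R * sval z.2.2 <= k%:R then H z else G (sh z)); split.
- apply: glue_cts => //; first exact: comp_cts csh cG.
  move=> z zk; rewrite HWk ?zk// /sh zk subrr clampI_le0//.
- move=> z; rewrite -natr1 => zk; rewrite ifF; last first.
    by apply/negbTE; rewrite -ltNge; lra.
  by rewrite /sh clampI_ge1 ?G1//; lra.
- move=> [d [l t]] /= zk; case: ifPn => [tk|]; first exact: (Hf (d, (l, t))).
  rewrite -ltNge => kt; apply: (@ball_split _ _ (f (l, cut_at k 0))).
    apply: (proj2 (osc _ _ _ _)); rewrite sval_cut_at ?(ltnW kN)//.
    have -> : sval t - k%:R / N%:R = (N%:R * sval t - k%:R) / N%:R.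
      by rewrite mulrBl mulrAC mulfV ?mul1r ?gt_eqF.
    rewrite normrM [`|N%:R^-1|]ger0_norm ?invr_ge0 ?(ltW NR0)//.
    rewrite ler_piMl ?invr_ge0 ?(ltW NR0)// ger0_norm ?subr_ge0 ?(ltW kt)//.
    by move: zk; rewrite -natr1; lra.
  exact: (Gf (sh (d, (l, t)))).
- move=> [d [l t]] /= zk Bz; case: ifPn => [tk|]; first exact: (Hh (d, (l, t))).
  rewrite -ltNge => kt; rewrite /sh /=.
  have [dl|[t0|t1]] : prod_bd A (m := m) (d, l) \/ t = zero \/ t = one.
    by move: Bz; rewrite /prod_bd /=; tauto.
  + rewrite Gh// sval_clampI ?cut_atE//.
    by rewrite subr_ge0 (ltW kt)/= lerBlDr addrC natr1.
  + by move: kt; rewrite t0 sval_zero mulr0 ltNge ler0n.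
  + move: zk kt; rewrite t1 sval_one mulr1 ler_nat ltr_nat => Nk _.
    have NE : N = k.+1 by apply/eqP; rewrite eqn_leq Nk.
    have tE : cut_at k.+1 0 = one.
      by apply: svalI_inj; rewrite sval_cut_at// NE divff ?pnatr_eq0.
    (* The last slab ends exactly at the wall of parameter 1. *)
    rewrite clampI_ge1 ?G1; last by rewrite NE -natr1 addrAC subrr add0r.
    by have [_ -> //] := HW (cut_at k.+1 0); rewrite tE// -t1.
Qed.

End cut.

(** The tolerances are chosen backwards: [d1] for the slabs, then [w] for the
    walls bounding them, then [d2] for the boundary map out of which the walls
    are filled. *)
Lemma fillable_cut K m (D : topologicalType) (A : set D) : closed A ->
  fillable K m A -> fillable K m (cyl_bd A) -> fillable K m.+1 A.
Proof.
move=> cA fA fcyl e e0.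
have e20 : 0 < e / 2 by rewrite divr_gt0.
have [d1 d10 hd1] := fcyl _ e20.
have d120 : 0 < d1 / 2 by rewrite divr_gt0.
pose w := Num.min (d1 / 2) e.
have w0 : 0 < w by rewrite lt_min d120.
have [d2 d20 hd2] := fA _ w0.
pose d := Num.min d2 w.
exists d; first by rewrite lt_min d20.
move=> f h cf Kf ch hf.
have osc0 : 0 < Num.min (d1 / 2) (e / 2) by rewrite lt_min d120.
have [N N0 osc] := uniform_cts_last cf osc0.
have wall t : exists W, is_wall A f h w t W.
  apply: (wall_exists cf ch _ Kf (d := d)) => //.
    by rewrite ge_min lexx orbT.
  move=> f' h' cf' Kf' ch' hf'; apply: hd2 => // z bz.
  by apply: le_ball (hf' _ bz); rewrite ge_min lexx.
have [W HW] := choice wall.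
have [||||H [cH _ Hf Hh]] := slabs_glue cA cf ch N0 Kf hd1 HW _ _ d10 _ _ (leqnn N).
- by rewrite ge_min lexx.
- by rewrite ge_min lexx orbT.
- move=> z bz; apply: le_ball (hf _ bz).
  by rewrite /d /w !ge_min lexx !orbT.
- by move=> l s t /(osc l) b; split; apply: le_ball b; rewrite ge_min lexx ?orbT.
have tN (z : D * (cell R m * I)) : N%:R * sval z.2.2 <= N%:R.
  by rewrite ler_piMr ?ler0n//; case/andP: (svalI_itv z.2.2).
by exists H; split => // z; [exact: Hh|exact: Hf].
Qed.

End fill.

(** * A cube as a quotient of the cylinder over a cube *)

Section radial.
Context {R : realType}.
Local Notation I := (unit_interval R).

(** The coordinate in [-1, 1]: scaling a cube about its centre is a
    multiplication in this coordinate. *)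
Definition centered (s : I) : R := 2 * sval s - 1.
Definition uncentered (a : R) : I := clampI ((1 + a) / 2).

Lemma centered_norm_le1 s : `|centered s| <= 1.
Proof.
by have /andP[s0 s1] := svalI_itv s; rewrite ler_norml /centered; apply/andP; split; lra.
Qed.

Lemma centeredK s : uncentered (centered s) = s.
Proof. by rewrite /uncentered /centered addrC subrK mulrC mulKf// clampI_sval. Qed.

Lemma uncenteredK a : `|a| <= 1 -> centered (uncentered a) = a.
Proof.
rewrite ler_norml => /andP[a0 a1]; rewrite /centered /uncentered sval_clampI; first by lra.
by apply/andP; split; lra.
Qed.

Lemma centered_cts : continuous centered.
Proof.
apply: addr_cts; last exact: cst_continuous.
by apply: mulr_cts svalI_cts; exact: cst_continuous.
Qed.

Lemma uncentered_cts : continuous uncentered.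
Proof.
apply: comp_cts clampI_cts; apply: mulr_cts; last exact: cst_continuous.
by apply: addr_cts; [exact: cst_continuous|move=> a; exact: cvg_id].
Qed.

Lemma norm_centered_end s : `|centered s| = 1 <-> s = zero \/ s = one.
Proof.
split=> [|[] ->]; last 2 first.
- by rewrite /centered sval_zero mulr0 sub0r normrN normr1.
- rewrite /centered sval_one mulr1 -[2]/(1 + 1) addrK normr1//.
move/eqP; rewrite eqr_norml ler01 andbT => /orP[] /eqP s1; [right|left].
  by apply: svalI_inj; rewrite sval_one; move: s1; rewrite /centered; lra.
by apply: svalI_inj; rewrite sval_zero; move: s1; rewrite /centered; lra.
Qed.

(** The max-norm distance to the centre; the boundary is the unit sphere. *)
Fixpoint cell_rad m : cell R m -> R :=
  if m is m'.+1 return cell R m -> R then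
    fun z => Num.max (cell_rad z.1) `|centered z.2|
  else fun _ => 0.

Fixpoint cell_scale (a : R) m : cell R m -> cell R m :=
  if m is m'.+1 return cell R m -> cell R m then
    fun z => (cell_scale a z.1, uncentered (a * centered z.2))
  else fun z => z.

Lemma cell_rad_ge0 m (z : cell R m) : 0 <= cell_rad z.
Proof. by elim: m z => [//|m IH] z /=; rewrite le_max IH. Qed.

Lemma cell_rad_le1 m (z : cell R m) : cell_rad z <= 1.
Proof.
elim: m z => [|m IH] z /=; first exact: ler01.
by rewrite ge_max IH centered_norm_le1.
Qed.

Lemma cell_rad_cts m : continuous (@cell_rad m).
Proof.
elim: m => [|m IH] /=; first exact: cst_continuous.
apply: maxr_cts; first exact: comp_cts (@fst_cts _ _) IH.
apply: (comp_cts (comp_cts (@snd_cts _ _) centered_cts)).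
exact: norm_continuous.
Qed.

Lemma cell_scale_cts (T : topologicalType) m (a : T -> R) (z : T -> cell R m) :
  continuous a -> continuous z -> continuous (fun t => cell_scale (a t) (z t)).
Proof.
elim: m z => [//|m IH] z ca cz /=; apply: pair_cts.
  by apply: (IH (fun t => (z t).1)) => //; exact: comp_cts cz (@fst_cts _ _).
apply: comp_cts uncentered_cts; apply: mulr_cts ca _.
exact: comp_cts (comp_cts cz (@snd_cts _ _)) centered_cts.
Qed.

Lemma cell_rad_bd m (z : cell R m) : cell_rad z = 1 <-> cell_bd z.
Proof.
elim: m z => [|m IH] z /=.
  by split=> // /eqP; rewrite eq_sym oner_eq0.
have := norm_centered_end z.2; have := IH z.1.
have := cell_rad_le1 z.1; have := centered_norm_le1 z.2.
move=> c1 r1 [rb br] [cb bc]; split.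
  have [_ e|_ e] := leP `|centered z.2| (cell_rad z.1); [left; exact: rb|right; exact: cb].
by case=> [/br|/bc] e; rewrite e; [rewrite max_l|rewrite max_r].
Qed.

Lemma cell_scale1 m (z : cell R m) : cell_scale 1 z = z.
Proof.
by elim: m z => [//|m IH] [z s] /=; rewrite IH mul1r centeredK.
Qed.

Lemma cell_scale0 m (z w : cell R m) : cell_scale 0 z = cell_scale 0 w.
Proof.
elim: m z w => [|m IH] z w /=; first by rewrite [z]thinmx0 [w]thinmx0.
by rewrite (IH z.1 w.1) !mul0r.
Qed.

Lemma cell_rad_scale a m (z : cell R m) : 0 <= a -> a * cell_rad z <= 1 ->
  cell_rad (cell_scale a z) = a * cell_rad z.
Proof.
move=> a0; elim: m z => [|m IH] z /=; first by rewrite mulr0.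
rewrite maxr_pMr// ge_max => /andP[az as_]; rewrite IH// uncenteredK.
  by rewrite normrM (ger0_norm a0).
by rewrite normrM (ger0_norm a0).
Qed.

Lemma cell_scaleM a b m (z : cell R m) : 0 <= a -> a * cell_rad z <= 1 ->
  cell_scale b (cell_scale a z) = cell_scale (b * a) z.
Proof.
move=> a0; elim: m z => [//|m IH] z /=.
rewrite maxr_pMr// ge_max => /andP[az as_]; rewrite IH// uncenteredK ?mulrA//.
by rewrite normrM (ger0_norm a0).
Qed.

Lemma cell_rad0 m (z w : cell R m) : cell_rad z = 0 -> z = cell_scale 0 w.
Proof.
elim: m z w => [|m IH] z w /=; first by rewrite [z]thinmx0 [w]thinmx0.
have := cell_rad_ge0 z.1; have := normr_ge0 (centered z.2) => c0 r0 m0.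
have /andP[r0' c0'] : (cell_rad z.1 <= 0) && (`|centered z.2| <= 0) by rewrite -ge_max m0.
rewrite -(IH z.1); last by apply/eqP; rewrite eq_le r0'.
rewrite mul0r; have : centered z.2 = 0 by apply/eqP; rewrite -normr_le0.
by move=> <-; rewrite centeredK; case: (z).
Qed.

Lemma cell_scale_inj a m (z w : cell R m) : 0 < a -> a * cell_rad z <= 1 ->
  a * cell_rad w <= 1 -> cell_scale a z = cell_scale a w -> z = w.
Proof.
move=> a0 az aw /(congr1 (@cell_scale a^-1 m)).
by rewrite !cell_scaleM ?(ltW a0)// mulVf ?gt_eqF// !cell_scale1.
Qed.

(** The pair (r * profile_scale r, profile_height r) runs, for r from 0 to 1,
    along the half square (0, 1), (1, 1), (1, -1), (0, -1), each side taking a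
    third of the time. Rotated about the axis, this broken line sweeps out the
    boundary of a cube: the top face, then the lateral faces, then the bottom
    face. *)
Definition profile_scale (r : R) : R := Num.min 1 (3 - 3 * r) / Num.max r 3^-1.
Definition profile_height (r : R) : R := Num.max (-1) (Num.min 1 (3 - 6 * r)).

Lemma profile_scale_cts : continuous profile_scale.
Proof.
have cid : continuous (fun r : R => r) by move=> r; exact: cvg_id.
apply: mulr_cts.
  apply: minr_cts; first exact: cst_continuous.
  apply: addr_cts; first exact: cst_continuous.
  by apply: oppr_cts; apply: mulr_cts cid; exact: cst_continuous.
apply: invr_cts => [r|]; first by rewrite gt_eqF// lt_max invr_gt0 ltr0n orbT.
by apply: maxr_cts cid _; exact: cst_continuous.
Qed.

Lemma profile_height_cts : continuous profile_height.
Proof.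
have cid : continuous (fun r : R => r) by move=> r; exact: cvg_id.
apply: maxr_cts; first exact: cst_continuous.
apply: minr_cts; first exact: cst_continuous.
apply: addr_cts; first exact: cst_continuous.
by apply: oppr_cts; apply: mulr_cts cid; exact: cst_continuous.
Qed.

Lemma profile_top (r : R) : r <= 3^-1 -> profile_scale r = 3 /\ profile_height r = 1.
Proof.
move=> r3; rewrite /profile_scale /profile_height max_r// min_l ?min_l; try lra.
by rewrite max_r; [split|]; lra.
Qed.

Lemma profile_side (r : R) : 3^-1 <= r <= 2 / 3 ->
  profile_scale r = r^-1 /\ profile_height r = 3 - 6 * r.
Proof.
move=> /andP[r3 r23]; rewrite /profile_scale /profile_height max_l// min_l ?min_r; try lra.
by rewrite max_r; [split|]; lra.
Qed.

Lemma profile_bot (r : R) : 2 / 3 <= r ->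
  profile_scale r = (3 - 3 * r) / r /\ profile_height r = -1.
Proof.
move=> r23; rewrite /profile_scale /profile_height max_l ?min_r; try lra.
by rewrite max_l; [split|]; lra.
Qed.

Lemma profile_case (r : R) :
  [\/ r <= 3^-1, 3^-1 < r < 2 / 3 | 2 / 3 <= r].
Proof.
have [?|r3] := leP r 3^-1; first by constructor 1.
have [?|?] := leP (2 / 3) r; first by constructor 3.
by constructor 2; apply/andP.
Qed.

Lemma profile_scale_gt0 (r : R) : r < 1 -> 0 < profile_scale r.
Proof.
move=> r1; rewrite /profile_scale divr_gt0 ?lt_min ?lt_max ?invr_gt0 ?ltr0n ?orbT//.
by rewrite ltr01 /=; lra.
Qed.

(** The height determines r along the lateral faces, the distance to the axis
    determines it on the bottom face; on the top face the scaling factor is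
    constant, and r need not be determined. *)
Lemma profile_inj (r s : R) : profile_height r = profile_height s ->
  profile_scale r * r = profile_scale s * s -> r = s \/ r <= 3^-1 /\ s <= 3^-1.
Proof.
case: (profile_case r) => [r3|/andP[r3 r3']|r3];
case: (profile_case s) => [s3|/andP[s3 s3']|s3].
- by move=> _ _; right.
- have [_ ->] := profile_top r3.
  have [|_ ->] := @profile_side s; first by rewrite !ltW.
  by move=> ? _; exfalso; lra.
- have [_ ->] := profile_top r3; have [_ ->] := profile_bot s3.
  by move=> ? _; exfalso; lra.
- have [_ ->] := profile_top s3.
  have [|_ ->] := @profile_side r; first by rewrite !ltW.
  by move=> ? _; exfalso; lra.
- have [|_ ->] := @profile_side r; first by rewrite !ltW.
  have [|_ ->] := @profile_side s; first by rewrite !ltW.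
  by move=> ? _; left; lra.
- have [|_ ->] := @profile_side r; first by rewrite !ltW.
  have [_ ->] := profile_bot s3.
  by move=> ? _; exfalso; lra.
- have [_ ->] := profile_top s3; have [_ ->] := profile_bot r3.
  by move=> ? _; exfalso; lra.
- have [|_ ->] := @profile_side s; first by rewrite !ltW.
  have [_ ->] := profile_bot r3.
  by move=> ? _; exfalso; lra.
- have [-> _] := profile_bot r3; have [-> _] := profile_bot s3.
  have r0 : r != 0 by rewrite gt_eqF//; lra.
  have s0 : s != 0 by rewrite gt_eqF//; lra.
  by rewrite !divfK// => _ ?; left; lra.
Qed.

Section wrap.
Context {m : nat}.

(** Wraps the m-cube around the boundary of the (m+1)-cube: spheres about the
    centre go to horizontal spheres, from the centre of the top face down to
    the centre of the bottom face, to which the whole boundary of the m-cube is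
    sent. *)
Definition cell_wrap (z : cell R m) : cell R m.+1 :=
  (cell_scale (profile_scale (cell_rad z)) z, uncentered (profile_height (cell_rad z))).

(** The bottom of the cylinder goes onto the boundary of the cube by
    [cell_wrap], its top to the centre. The proof that the resulting map is a
    quotient map, up to collapsing the top and the sides, is [cone_wrap_surj]
    and [cone_wrap_fiber]. *)
Definition cone_wrap (p : cell R m * I) : cell R m.+1 :=
  cell_scale (1 - sval p.2) (cell_wrap p.1).

Lemma cell_wrap_cts : continuous cell_wrap.
Proof.
apply: pair_cts.
  apply: cell_scale_cts; first exact: comp_cts (@cell_rad_cts m) profile_scale_cts.
  by move=> z; exact: cvg_id.
exact: comp_cts (comp_cts (@cell_rad_cts m) profile_height_cts) uncentered_cts.
Qed.

Lemma cone_wrap_cts : continuous cone_wrap.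
Proof.
apply: (@cell_scale_cts _ m.+1); last exact: comp_cts (@fst_cts _ _) cell_wrap_cts.
apply: addr_cts; first exact: cst_continuous.
by apply: oppr_cts; exact: comp_cts (@snd_cts _ _) svalI_cts.
Qed.

Lemma profile_scale_ge0 r : r <= 1 -> 0 <= profile_scale r.
Proof.
move=> r1; rewrite /profile_scale divr_ge0 ?le_min ?ler01 ?le_max ?invr_ge0 ?ler0n ?orbT//=.
by lra.
Qed.

Lemma profile_scale_rad_le1 r : 0 <= r -> r <= 1 -> profile_scale r * r <= 1.
Proof.
move=> r0 r1; case: (profile_case r) => [/[dup] ? /profile_top[-> _]|
  /andP[? ?]|/[dup] ? /profile_bot[-> _]].
- by lra.
- have [|-> _] := @profile_side r; first by apply/andP; split; lra.
  by rewrite mulVf// gt_eqF//; lra.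
- by rewrite divfK ?gt_eqF//; lra.
Qed.

Lemma profile_height_norm_le1 r : `|profile_height r| <= 1.
Proof.
by rewrite ler_norml /profile_height le_max lexx/= ge_max ge_min lexx orTb; lra.
Qed.

Lemma cell_rad_wrap (z : cell R m) : cell_rad (cell_wrap z) = 1.
Proof.
have r0 := cell_rad_ge0 z; have r1 := cell_rad_le1 z.
have xr := profile_scale_rad_le1 r0 r1.
rewrite /= cell_rad_scale ?profile_scale_ge0// uncenteredK ?profile_height_norm_le1//.
case: (profile_case (cell_rad z)) => [/[dup] ? /profile_top[_ ->]|
  /andP[? ?]|/[dup] ? /profile_bot[_ ->]].
- by rewrite normr1 max_r.
- have [|e _] := @profile_side (cell_rad z); first by apply/andP; split; lra.
  by rewrite e mulVf ?gt_eqF ?max_l ?profile_height_norm_le1//; lra.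
- by rewrite normrN normr1 max_r.
Qed.

Lemma cell_wrap_bd (z w : cell R m) : cell_bd z -> cell_bd w -> cell_wrap z = cell_wrap w.
Proof.
move=> /cell_rad_bd z1 /cell_rad_bd w1; rewrite /cell_wrap z1 w1.
have [|-> _] := @profile_bot 1; first by lra.
have -> : (3 - 3 * 1) / 1 = 0 :> R by rewrite mulr1 subrr mul0r.
by rewrite (cell_scale0 z w).
Qed.

Lemma cell_wrap_inj (z w : cell R m) : cell_wrap z = cell_wrap w ->
  z = w \/ cell_bd z /\ cell_bd w.
Proof.
move=> zw.
have zw1 : cell_scale (profile_scale (cell_rad z)) z =
    cell_scale (profile_scale (cell_rad w)) w.
  by have /(congr1 fst) := zw.
have zw2 : profile_height (cell_rad z) = profile_height (cell_rad w).
  have /(congr1 (fun p => centered p.2)) := zw.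
  by rewrite /= !uncenteredK ?profile_height_norm_le1.
have z0 := cell_rad_ge0 z; have z1 := cell_rad_le1 z.
have w0 := cell_rad_ge0 w; have w1 := cell_rad_le1 w.
have zx := profile_scale_rad_le1 z0 z1; have wx := profile_scale_rad_le1 w0 w1.
have zwr : profile_scale (cell_rad z) * cell_rad z = profile_scale (cell_rad w) * cell_rad w.
  have zs := cell_rad_scale (profile_scale_ge0 z1) zx.
  have ws := cell_rad_scale (profile_scale_ge0 w1) wx.
  by rewrite -zs -ws zw1.
have [zwE|[z3 w3]] := profile_inj zw2 zwr; last first.
  have [zxE _] := profile_top z3; have [wxE _] := profile_top w3.
  by left; apply: (@cell_scale_inj 3); [|lra|lra|rewrite -{1}zxE -wxE].
move: z1; rewrite le_eqVlt => /orP[/eqP z1|z1].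
  by right; split; apply/cell_rad_bd; rewrite -?zwE.
left; apply: (cell_scale_inj (profile_scale_gt0 z1)) => //; first by rewrite zwE.
by rewrite {2}zwE.
Qed.

Lemma cell_wrap_surj (m0 : (0 < m)%N) (y : cell R m.+1) : cell_rad y = 1 ->
  exists z, cell_wrap z = y.
Proof.
case: y => Z b /= yr.
have Z0 := cell_rad_ge0 Z; have Z1 := cell_rad_le1 Z; have b1 := centered_norm_le1 b.
have [w wb] : exists w : cell R m, cell_bd w.
  case: (m) m0 => [//|m' _]; exists (mk_cell m' (fun=> 0), one).
  by right; right.
have [bE|bE|ZE] : [\/ centered b = 1, centered b = -1 | cell_rad Z = 1 /\ `|centered b| < 1].
  move: b1; rewrite le_eqVlt => /orP[/eqP|b1].
    move/eqP; rewrite eqr_norml ler01 andbT => /orP[] /eqP ->;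
      [by constructor 1|by constructor 2].
  constructor 3; split=> //; move: yr.
  have [bZ|Zb] := leP `|centered b| (cell_rad Z); first by [].
  by move=> b1'; move: b1; rewrite b1' ltxx.
- have s0 : (0 : R) <= 3^-1 by rewrite invr_ge0.
  have s1 : 3^-1 * cell_rad Z <= 1 by lra.
  exists (cell_scale 3^-1 Z); rewrite /cell_wrap cell_rad_scale//.
  have [|-> ->] := @profile_top (3^-1 * cell_rad Z); first by lra.
  by rewrite cell_scaleM// mulfV ?pnatr_eq0// cell_scale1 -bE centeredK.
(* On the bottom face, the centre comes from the boundary, and a point at distance
   a from the axis comes from distance 1 - a / 3. *)
- have [Zr0|Zr0] := eqVneq (cell_rad Z) 0.
    exists w; rewrite /cell_wrap (iffRL (cell_rad_bd w) wb).
    have [|-> ->] := @profile_bot 1; first by lra.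
    have -> : (3 - 3 * 1) / 1 = 0 :> R by rewrite mulr1 subrr mul0r.
    by rewrite -bE centeredK (cell_rad0 w Zr0).
  have Zp : 0 < cell_rad Z by rewrite lt_neqAle eq_sym Zr0.
  pose r := 1 - cell_rad Z / 3.
  have r0 : 0 <= r / cell_rad Z by rewrite divr_ge0 /r//; lra.
  have rE : r / cell_rad Z * cell_rad Z = r by rewrite divfK.
  have r1 : r / cell_rad Z * cell_rad Z <= 1 by rewrite rE /r; lra.
  exists (cell_scale (r / cell_rad Z) Z); rewrite /cell_wrap cell_rad_scale// rE.
  have [|-> ->] := @profile_bot r; first by rewrite /r; lra.
  rewrite cell_scaleM//.
  have -> : (3 - 3 * r) / r * (r / cell_rad Z) = 1.
    have rn0 : r != 0 by rewrite gt_eqF// /r; lra.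
    have -> : 3 - 3 * r = cell_rad Z by rewrite /r; lra.
    by rewrite -mulrA mulKf// divff.
  by rewrite cell_scale1 -bE centeredK.
- case: ZE => ZE; rewrite ltr_norml => /andP[b0 b1'].
  pose r := (3 - centered b) / 6.
  have r0 : 0 < r by rewrite /r; lra.
  have rE : r * cell_rad Z = r by rewrite ZE mulr1.
  have r1 : r * cell_rad Z <= 1 by rewrite rE /r; lra.
  exists (cell_scale r Z); rewrite /cell_wrap cell_rad_scale ?(ltW r0)// rE.
  have [|-> ->] := @profile_side r; first by apply/andP; split; rewrite /r; lra.
  rewrite cell_scaleM ?(ltW r0)// mulVf ?gt_eqF// cell_scale1.
  have -> : 3 - 6 * r = centered b by rewrite /r; lra.
  by rewrite centeredK.
Qed.

Lemma cell_rad_cone_wrap p : cell_rad (cone_wrap p) = 1 - sval p.2.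
Proof.
have /andP[s0 s1] := svalI_itv p.2.
by rewrite cell_rad_scale ?cell_rad_wrap ?mulr1//; lra.
Qed.

Lemma cone_wrap0 z : cone_wrap (z, zero) = cell_wrap z.
Proof. by rewrite /cone_wrap sval_zero subr0 cell_scale1. Qed.

Lemma cone_wrap_surj (m0 : (0 < m)%N) y : exists p, cone_wrap p = y.
Proof.
have r0 := cell_rad_ge0 y; have r1 := cell_rad_le1 y.
have [y0|y0] := eqVneq (cell_rad y) 0.
  exists (mk_cell m (fun=> 0), one); rewrite /cone_wrap sval_one subrr.
  by rewrite -(cell_rad0 _ y0).
have yp : 0 < cell_rad y by rewrite lt_neqAle eq_sym y0.
have yi : (cell_rad y)^-1 * cell_rad y <= 1 by rewrite mulVf.
have [|z zy] := cell_wrap_surj m0 (y := cell_scale (cell_rad y)^-1 y).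
  by rewrite cell_rad_scale ?mulVf// invr_ge0.
exists (z, clampI (1 - cell_rad y)); rewrite /cone_wrap zy sval_clampI.
  by rewrite subKr cell_scaleM ?invr_ge0// mulfV// cell_scale1.
by apply/andP; split; lra.
Qed.

Lemma cone_wrap_fiber p q : cone_wrap p = cone_wrap q ->
  p.2 = q.2 /\ [\/ p.2 = one, p.1 = q.1 | cell_bd p.1 /\ cell_bd q.1].
Proof.
move=> pq; have s_eq : p.2 = q.2.
  apply: svalI_inj; have := congr1 (@cell_rad m.+1) pq.
  by rewrite !cell_rad_cone_wrap; lra.
split=> //; have /andP[_ s1] := svalI_itv p.2.
move: s1; rewrite le_eqVlt => /orP[/eqP s1|s1].
  by constructor 1; exact: svalI_inj.
have : cell_wrap p.1 = cell_wrap q.1.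
  move: pq; rewrite /cone_wrap -s_eq; apply: cell_scale_inj; rewrite ?cell_rad_wrap ?mulr1.
  - by rewrite subr_gt0.
  - by have := svalI_itv p.2; lra.
  - by have := svalI_itv p.2; lra.
by move/cell_wrap_inj => [|]; [constructor 2|constructor 3].
Qed.

End wrap.
End radial.

(** * Compactness and the cube of row vectors *)

(** A continuous surjection from a compact space to a Hausdorff space is
    closed, hence a quotient map. *)
Lemma compact_quotient_cts {S T U : topologicalType} (p : S -> T) (g : S -> U)
    (F : T -> U) : compact [set: S] -> hausdorff_space T ->
  continuous p -> (forall y, exists x, p x = y) -> continuous g ->
  (forall x, F (p x) = g x) -> continuous F.
Proof.
move=> cS hT cp sp cg Fpg; apply/continuous_closedP => C cC.
have -> : F @^-1` C = p @` (g @^-1` C).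
  apply/seteqP; split=> [y /= Fy|_ [x /= gx <-]]; last by rewrite /= Fpg.
  by have [x xy] := sp y; exists x => //=; rewrite -Fpg xy.
apply: compact_closed => //; apply: continuous_compact.
  exact: continuous_subspaceT.
apply: subclosed_compact cS _ => //.
by apply: preimage_closed cC; exact: in1W.
Qed.

Section cube_cell.
Context {R : realType} {m : nat}.
Local Notation I := (unit_interval R).

Lemma of_cell_subproof (z : cell R m) :
  (\row_i cell_coord z i : 'rV[R]_m) \in unit_cube R m.
Proof. by apply/mem_set => i; rewrite mxE cell_coord_itv. Qed.

Definition of_cell (z : cell R m) : unit_cube R m :=
  exist (fun t : 'rV[R]_m => t \in unit_cube R m) _ (of_cell_subproof z).

Definition cube_coord (t : unit_cube R m) (i : nat) : R :=
  oapp (fun o => sval t ord0 o) 0 (insub i).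

Definition to_cell (t : unit_cube R m) : cell R m := mk_cell m (cube_coord t).

Lemma cube_coordE t (i : 'I_m) : cube_coord t i = sval t ord0 i.
Proof. by rewrite /cube_coord valK. Qed.

Lemma to_cell_coord t (i : 'I_m) : cell_coord (to_cell t) i = sval t ord0 i.
Proof.
rewrite cell_coord_mk ?cube_coordE//.
by case: t => t /= /set_mem; exact.
Qed.

Lemma of_cellK : cancel of_cell to_cell.
Proof.
move=> z; apply: cell_eq => i im.
by rewrite (to_cell_coord _ (Ordinal im)) mxE.
Qed.

Lemma to_cellK : cancel to_cell of_cell.
Proof.
move=> t; apply: val_inj; apply/rowP => i.
by rewrite [LHS]mxE to_cell_coord.
Qed.

Lemma of_cell_cts : continuous of_cell.
Proof.
apply: continuous_comp_initial => z A [P Pz PA].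
have : \forall w \near z, forall ij : 'I_1 * 'I_m, P ij.1 ij.2 (cell_coord w ij.2).
  apply: filter_forall => -[i j] /=; apply: (@cell_coord_cts R m j z).
  by have := Pz i j; rewrite mxE.
by apply: filterS => w Hw; apply: PA => i j; rewrite mxE; exact: (Hw (i, j)).
Qed.

Lemma to_cell_cts : continuous to_cell.
Proof.
apply: mk_cell_cts => i im.
have E : (fun t => cube_coord t i) = (fun t => sval t ord0 (Ordinal im)).
  by apply/funext => t; rewrite -cube_coordE.
rewrite E; apply: comp_cts (@coord_continuous _ _ _ _ _).
exact: (@initial_continuous _ _ (@set_val _ (unit_cube R m))).
Qed.

Lemma to_cell_bd t : cell_bd (to_cell t) <-> cube_boundary R m t.
Proof.
split=> [/cell_bdP[i im]|[i]].
  by rewrite (to_cell_coord _ (Ordinal im)); exists (Ordinal im).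
by rewrite -to_cell_coord => ti; apply/cell_bdP; exists i.
Qed.

Lemma of_cell_bd z : cube_boundary R m (of_cell z) <-> cell_bd z.
Proof. by rewrite -to_cell_bd of_cellK. Qed.

Lemma cube_compact : compact [set: unit_cube R m].
Proof.
have -> : [set: unit_cube R m] = of_cell @` setT.
  by apply/seteqP; split=> // t _; exists (to_cell t) => //; exact: to_cellK.
apply: continuous_compact (@cell_compact R m).
exact: continuous_subspaceT of_cell_cts.
Qed.

End cube_cell.

(** * Filling small spheres *)

Section sphere.
Context {R : realType} {X : topologicalType} (V U : set X) (VU : V `<=` U).
Local Notation I := (unit_interval R).

Lemma path_fill :
  (forall v w : V,
     inhabited {path unit_interval R from set_incl VU v to set_incl VU w}) ->
  forall h : cell R 1 -> X, (forall z, cell_bd z -> V (h z)) ->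
  exists F : cell R 1 -> X, [/\ continuous F, forall z, cell_bd z -> F z = h z &
    forall z, U (F z)].
Proof.
move=> pathVU h hV.
have b0 : @cell_bd R 1 (0, zero) by right; left.
have b1 : @cell_bd R 1 (0, one) by right; right.
have [p] := pathVU (exist _ (h (0, zero)) (mem_set (hV _ b0)))
  (exist _ (h (0, one)) (mem_set (hV _ b1))).
exists (fun z => sval (p z.2)); split.
- apply: (comp_cts (comp_cts (@snd_cts _ _) _)).
    exact: cts_fun.
  exact: (@initial_continuous _ _ (@set_val _ U)).
- move=> [z s] /= [[]|[]] ->; rewrite [z]thinmx0.
    by rewrite path_zero.
  by rewrite path_one.
- by move=> z; exact: set_mem (svalP (p z.2)).
Qed.

(** Composed with [cell_wrap], the map [h] is constant on the boundary of the
    j-cube, hence represents an element of the j-th homotopy group of [V],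
    which dies in [U]. The null-homotopy is constant on the sides and on the
    top of the cylinder, so that it is constant on the fibres of [cone_wrap]
    and descends to the (j+1)-cube. *)
Lemma sphere_fill j : (0 < j)%N ->
  (forall (v : V) (c : homotopy_group R j v),
     homotopy_group_map (@set_incl_continuous _ _ _ VU) c =
     \pi_(homotopy_group R j (set_incl VU v)) (cst_hom R j (set_incl VU v))) ->
  forall h : cell R j.+1 -> X, {within cell_bd (m := j.+1), continuous h} ->
  (forall z, cell_bd z -> V (h z)) ->
  exists F : cell R j.+1 -> X, [/\ continuous F,
    forall z, cell_bd z -> F z = h z & forall z, U (F z)].
Proof.
move=> j0 triv h ch hV.
have [z0 bz0] : exists z : cell R j, cell_bd z.
  case: (j) j0 => [//|j' _]; exists (mk_cell j' (fun=> 0), one).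
  by right; right.
have wrapV (z : cell R j) : cell_bd (cell_wrap z).
  by apply/cell_rad_bd; exact: cell_rad_wrap.
have ch_wrap : continuous (fun z : cell R j => h (cell_wrap z)).
  apply: (@within_setT_cts _ _ _ setT) => //.
  by apply: within_comp ch => //; exact: cell_wrap_cts.
pose v : V := exist _ (h (cell_wrap z0)) (mem_set (hV _ (wrapV z0))).
pose gam (t : unit_cube R j) : V :=
  exist _ (h (cell_wrap (to_cell t))) (mem_set (hV _ (wrapV (to_cell t)))).
have cgam : continuous gam.
  apply: continuous_comp_initial.
  exact: comp_cts (@to_cell_cts R j) ch_wrap.
have bgam t : cube_boundary R j t -> gam t = v.
  move=> /to_cell_bd bt; apply: val_inj => /=.
  by rewrite (cell_wrap_bd bt bz0).
have := triv v (\pi_(homotopy_group R j v) (mk_hom cgam bgam)).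
rewrite homotopy_group_mapE => /homotopy_groupP[H [cH H0 H1 Hb]].
pose g (p : cell R j * I) : X := sval (H (of_cell p.1, p.2)).
have cg : continuous g.
  apply: (@comp_cts _ _ _ (fun p => H (of_cell p.1, p.2))).
    apply: comp_cts cH; apply: pair_cts (@snd_cts _ _).
    exact: comp_cts (@fst_cts _ _) (@of_cell_cts R j).
  exact: (@initial_continuous _ _ (@set_val _ U)).
have g0 z : g (z, zero) = h (cell_wrap z) by rewrite /g /= H0 /= of_cellK.
have g1 z : g (z, one) = h (cell_wrap z0) by rewrite /g /= H1.
have gb z s : cell_bd z -> g (z, s) = h (cell_wrap z0).
  move=> bz; rewrite /g /= Hb; last exact/of_cell_bd.
  by rewrite /= of_cellK (cell_wrap_bd bz bz0).
(* [F] is [g] precomposed with an arbitrary section of [cone_wrap]. *)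
have [F FE] : exists F : cell R j.+1 -> X, forall p, F (cone_wrap p) = g p.
  have [s sK] := choice (@cone_wrap_surj R j j0).
  exists (fun y => g (s y)) => p.
  move: (s (cone_wrap p)) (sK (cone_wrap p)) => q /cone_wrap_fiber[].
  case: q p => [z t] [w u] /= -> [->|->|[bz bw]] //.
    by rewrite !g1.
  by rewrite !gb.
exists F; split.
- apply: (compact_quotient_cts _ _ (@cone_wrap_cts R j)
    (cone_wrap_surj j0) cg FE).
    rewrite -setXTT; apply: compact_setX; first exact: cell_compact.
    exact: interval_compact.
  exact: cell_hausdorff.
- move=> y /cell_rad_bd y1; have [z <-] := cell_wrap_surj j0 y1.
  by rewrite -cone_wrap0 FE g0 cone_wrap0.
- move=> y; have [p <-] := cone_wrap_surj j0 y; rewrite FE.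
  exact: set_mem (svalP (H _)).
Qed.

End sphere.

Section local_connectivity.
Context {R : realType} {X : metricType R} (n : nat).
Hypothesis hX : locally_n_connected R n X.
Variable K : set X.
Hypothesis cK : compact K.

Lemma locally_fill j (p : X) (e : R) : (j <= n)%N -> 0 < e ->
  exists2 d : R, 0 < d & forall h : cell R j.+1 -> X,
    {within cell_bd (m := j.+1), continuous h} ->
    (forall z, cell_bd z -> ball p d (h z)) ->
    exists F : cell R j.+1 -> X, [/\ continuous F,
      forall z, cell_bd z -> F z = h z & forall z, ball p e (F z)].
Proof.
move=> jn e0; have [V [VU [nV pathVU trivVU]]] := hX (nbhsx_ballx p e e0).
have /nbhs_ballP[d /= d0 dV] := nV.
exists d => // h ch hd.
have hV (z : cell R j.+1) : cell_bd z -> V (h z) by move=> /hd; exact: dV.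
case: j jn h ch hd hV => [|j] jn h ch hd hV; first exact: (path_fill pathVU).
have triv (v : V) c := trivVU j.+1 v jn c.
exact: (@sphere_fill _ _ _ _ VU j.+1 _ triv h ch hV).
Qed.

(** A radius that works at [p] for the smaller ball works, once halved, at all
    points near [p]; compactness does the rest. *)
Lemma uniform_fill j : (j <= n)%N -> fillable K 0 (@cell_bd R j.+1).
Proof.
move=> jn e e0.
pose P (d : R) (p : X) := forall h : cell R j.+1 -> X,
    {within cell_bd (m := j.+1), continuous h} ->
    (forall z, cell_bd z -> ball p d (h z)) ->
    exists F : cell R j.+1 -> X, [/\ continuous F,
      forall z, cell_bd z -> F z = h z & forall z, ball p e (F z)].
have e20 : 0 < e / 2 by rewrite divr_gt0.
have unifP : \forall d \near (0 : R)^'+, K `<=` P d.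
  apply: (iffLR (compact_near_coveringP K) cK) => p Kp.
  have [d d0 dP] := locally_fill p jn e20.
  have d20 : 0 < d / 2 by rewrite divr_gt0.
  near=> p' d' => h ch hd'.
  have pp' : ball p (d / 2) p' by near: p'; exact: nbhsx_ballx.
  have pe : ball p (e / 2) p' by near: p'; exact: nbhsx_ballx.
  have dd' : d' <= d / 2 by near: d'; exact: nbhs_right_le.
  have [|F [cF Fh Fe]] := dP h ch.
    by move=> z /hd' b; apply: ball_split pp' _; exact: le_ball b.
  by exists F; split => // z; apply: (@ball_splitr _ _ p) (Fe z).
have [d [d0 dP]] : exists d : R, 0 < d /\ K `<=` P d.
  near (0 : R)^'+ => d; exists d; split; first by near: d; exact: nbhs_right_gt.
  by near: d.
exists d => // f h cf Kf ch hf.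
have [||F [cF Fh Fe]] := dP (f 0) (Kf 0) (fun z => h (z, 0)).
- apply: (within_comp _ _ ch); last by move=> z bz; left.
  by apply: pair_cts; [move=> z; exact: cvg_id|exact: cst_continuous].
- by move=> z bz; apply: (hf (z, 0)); left.
exists (fun z => F z.1); split.
- exact: comp_cts (@fst_cts _ _) cF.
- by move=> [z l] [bz|[]]; rewrite [l]thinmx0 Fh.
- by move=> [z l]; rewrite [l]thinmx0.
Unshelve. all: by end_near. Qed.

(** Each cut of a long coordinate may add it to the block, so the dimension of
    the blocks never exceeds j+m+1, and only spheres of dimension at most n are
    filled. *)
Lemma fillable_cells m j : (j + m <= n)%N -> fillable K m (@cell_bd R j.+1).
Proof.
elim: m j => [|m IH] j jmn; first by apply: uniform_fill; rewrite -(addn0 j).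
apply: fillable_cut.
- exact: cell_bd_closed.
- by apply: IH; apply: leq_trans jmn; rewrite leq_add2l.
- by apply: (IH j.+1); rewrite addSnnS.
Qed.

End local_connectivity.

(** * Nearby maps are homotopic *)

Section conclusion.
Context {R : realType} {X : metricType R} (n : nat) (x : X).
Local Notation I := (unit_interval R).

(** By compactness of the cube it suffices to control [g] near each point [t]:
    the set [C] below is a compact neighbourhood of [t] that [f], hence any
    nearby [g], maps into a small ball. *)
Lemma near_hom_fun (f : hom_space R n x) (d : R) : 0 < d ->
  \forall g \near f, forall t, ball (hom_fun f t) d (hom_fun g t).
Proof.
move=> d0.
suff H : nbhs (sval f : {compact-open, unit_cube R n -> X})
    [set g | [set: unit_cube R n] `<=` [set t | ball (hom_fun f t) d (g t)]].
  have Hf : nbhs f [set g : hom_space R n x |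
      [set: unit_cube R n] `<=` [set t | ball (hom_fun f t) d (hom_fun g t)]].
    exact: (@initial_continuous _ _ (@set_val _ (hom_set R n x)) f _ H).
  by apply: filterS Hf => g Hg t; exact: Hg.
have cf := @hom_fun_continuous R n X x f.
apply: (iffLR (compact_near_coveringP _) (@cube_compact R n) _
  (nbhs (sval f : {compact-open, unit_cube R n -> X}))
  (fun g t => ball (hom_fun f t) d (g t)) _) => t _.
have d20 : 0 < d / 2 by rewrite divr_gt0.
have d40 : 0 < d / 2 / 2 by rewrite divr_gt0.
have d80 : 0 < d / 2 / 2 / 2 by rewrite divr_gt0.
pose C := hom_fun f @^-1` closure (ball (hom_fun f t) (d / 2 / 2 / 2)).
pose O := (ball (hom_fun f t) (d / 2))°.
have CO u : C u -> O (hom_fun f u).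
  move=> Cu; have fu : ball (hom_fun f t) (d / 2 / 2) (hom_fun f u).
    exact: subset_closure_half Cu.
  apply: filterS (nbhsx_ballx (hom_fun f u) _ d40) => y fy.
  exact: ball_split fu fy.
have cC : compact C.
  apply: subclosed_compact (@cube_compact R n) _ => //.
  by apply: preimage_closed; [exact: in1W|exact: closed_closure].
have nC : nbhs t C.
  have nb : nbhs t (hom_fun f @^-1` ball (hom_fun f t) (d / 2 / 2 / 2)).
    exact: cf t _ (nbhsx_ballx _ _ d80).
  by apply: filterS nb => u; exact: (@subset_closure _ _ (hom_fun f u)).
have nO : nbhs (sval f : {compact-open, unit_cube R n -> X})
    [set g | g @` C `<=` O].
  apply: open_nbhs_nbhs; split; first exact: compact_open_open (open_interior _).
  by move=> _ [u Cu <-]; exact: CO.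
exists (C, [set g | g @` C `<=` O]); first by split.
move=> [u g] [/= Cu gCO]; apply: (@ball_splitr _ _ (hom_fun f t)).
  exact: interior_subset (CO _ Cu).
by apply: interior_subset; apply: gCO; exists u.
Qed.

(** The homotopy is obtained by filling, with the time interval [cell R 1] as
    block, the boundary map given by [f] and [g] on the ends and by the base
    point on the sides. The size of the homotopy is irrelevant, whence the
    tolerance 1. *)
Lemma near_homotopic (hX : locally_n_connected R n X) (f : hom_space R n x) :
  \forall g \near f, homotopic f g.
Proof.
have cf := @hom_fun_continuous R n X x f.
pose K := hom_fun f @` setT.
have cK : compact K.
  by apply: continuous_compact (@cube_compact R n); exact: continuous_subspaceT.
have [d d0 fill] := fillable_cells hX cK (leqnn n : 0 + n <= n)%N ltr01.
apply: filterS (near_hom_fun f d0) => g fg.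
have cg := @hom_fun_continuous R n X x g.
pose h (z : cell R 1 * cell R n) : X :=
  if z.1.2 == zero then hom_fun f (of_cell z.2) else
  if z.1.2 == one then hom_fun g (of_cell z.2) else x.
have hx (z : cell R 1 * cell R n) : cell_bd z.2 -> h z = x.
  by move=> /of_cell_bd bz; rewrite /h !hom_fun_boundary// !if_same.
have cs : continuous (fun z : cell R 1 * cell R n => z.1.2).
  exact: comp_cts (@fst_cts _ _) (@snd_cts _ _).
have cl : continuous (fun z : cell R 1 * cell R n => of_cell z.2).
  exact: comp_cts (@snd_cts _ _) (@of_cell_cts R n).
have [||||H [cH Hh _]] := fill (fun l => hom_fun f (of_cell l)) h.
- exact: comp_cts (@of_cell_cts R n) cf.
- by move=> l; exists (of_cell l).
- have -> : prod_bd (cell_bd (m := 1)) (m := n) =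
      [set z : cell R 1 * cell R n | cell_bd z.2] `|`
      ([set z | z.1.2 = zero] `|` [set z | z.1.2 = one]).
    by apply/seteqP; split=> -[[z s] l]; rewrite /prod_bd /=; tauto.
  apply: glue_ends_cts.
  + apply: (preimage_closed _ (@cell_bd_closed R n)).
    exact: in1W (@snd_cts _ _).
  + exact: cs.
  + exact: comp_cts cl cf.
  + exact: comp_cts cl cg.
  + by apply: continuous_subspaceT; exact: cst_continuous.
  + by move=> z /of_cell_bd bz _; exact: hom_fun_boundary.
  + by move=> z /of_cell_bd bz _; exact: hom_fun_boundary.
- move=> [[z s] l]; rewrite /h /= => bz.
  case: eqP => [s0|s0]; first exact: ballxx.
  case: eqP => [s1|s1]; first exact: fg.
  have /of_cell_bd bl : cell_bd l by case: bz => //= -[|[]].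
  by rewrite hom_fun_boundary//; exact: ballxx.
exists (fun p => H ((0, p.2), to_cell p.1)); split.
- apply: comp_cts cH; apply: pair_cts.
    by apply: pair_cts (@snd_cts _ _); exact: cst_continuous.
  exact: comp_cts (@fst_cts _ _) (@to_cell_cts R n).
- by move=> t; rewrite Hh /h /= ?eqxx ?to_cellK//; left; right; left.
- by move=> t; rewrite Hh /h /= ?one_eq_zero ?eqxx ?to_cellK//; left; right; right.
- move=> t s bt; have bl : cell_bd (to_cell t) by apply/to_cell_bd.
  by rewrite Hh ?hx ?hom_fun_boundary//; right.
Qed.

End conclusion.

Theorem theorem3p6 (R : realType) (n : nat) (hn : (1 <= n)%N)
    (X : metricType R) (hX : locally_n_connected R n X) (x : X) :
  forall A : set (top_homotopy_group R n x), open A.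
Proof.
move=> A; rewrite /open /= /quotient_open openE => f /= Af.
rewrite /interior; apply: filterS (near_homotopic hX f) => g fg /=.
suff <- : \pi_(top_homotopy_group R n x) f = \pi_(top_homotopy_group R n x) g by [].
exact/homotopy_groupP.
Qed.
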